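(* Let $X$ and $Y$ be independent generalised random variables, represented by the pairs $(T_1,\varphi_1)$ and $(T_2,\varphi_2)$ respectively. Then $${}^{(\varphi)}K_{X+Y}(t)={}^{(\varphi_1)}K_X(t)+{}^{(\varphi_2)}K_Y(t),$$ whenever the logarithms are defined.
   Context: $\mathcal{S}$ and $\mathcal{S}'$ denote Schwartz functions and tempered distributions. A generalised random variable on $\mathbb{R}$ is represented by a pair $(T,\varphi)$ with $T\in\mathcal{S}'(\mathbb{R})$ (its law) and $\varphi\in\mathcal{S}(\mathbb{R})$ (the kernel); its weak characteristic function is ${}^{(\varphi)}\phi(t):=\langle T,e^{itx}\varphi(x)\rangle$, $t\in\mathbb{R}$. When ${}^{(\varphi)}\phi(t)\ne0$ in a neighbourhood of $t=0$, its weak cumulant generating function is ${}^{(\varphi)}K(t):=\log{}^{(\varphi)}\phi(t)$. $X$ and $Y$ are independent if their joint representation is the product pair $(T_1\otimes T_2,\varphi_1\otimes\varphi_2)$ on $\mathbb{R}^2$, where $\otimes$ is the tensor product; the weak characteristic function of $X+Y$ is then ${}^{(\varphi)}\phi_{X+Y}(t)=\langle T_1\otimes T_2,e^{it(x+y)}\varphi_1(x)\varphi_2(y)\rangle$, and ${}^{(\varphi)}K_{X+Y}$ is its logarithm.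
   Formalization: The logarithms are read as continuous branches on open intervals around 0 where the weak characteristic functions do not vanish; the identity is stated up to a constant 2πik, with exact equality when the branches agree at t=0, since it fails for e.g. principal logarithms. *)

(* Defs.v *)
From Stdlib Require Import Reals.
From Coquelicot Require Import Coquelicot.
Open Scope R_scope.

Definition Cexp (z : C) : C := (exp (Re z) * cos (Im z), exp (Re z) * sin (Im z)).

(** * Complex-valued Schwartz functions on [R] and on [R^2] *)

Definition smooth (f : R -> C) : Prop :=
  forall n x, ex_derive_n (fun s => Re (f s)) n x /\ ex_derive_n (fun s => Im (f s)) n x.

Definition Cderive_n (f : R -> C) (n : nat) (x : R) : C :=
  (Derive_n (fun s => Re (f s)) n x, Derive_n (fun s => Im (f s)) n x).

Definition schwartz (f : R -> C) : Prop :=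
  smooth f /\
  forall k l, exists M, forall x, Rabs x ^ k * Cmod (Cderive_n f l x) <= M.

Definition smooth2 (f : R -> R -> C) : Prop :=
  forall n x y, ex_diff_n (fun u v => Re (f u v)) n x y /\
                ex_diff_n (fun u v => Im (f u v)) n x y.

Definition Cpartial (f : R -> R -> C) (p q : nat) (x y : R) : C :=
  (partial_derive p q (fun u v => Re (f u v)) x y,
   partial_derive p q (fun u v => Im (f u v)) x y).

Definition schwartz2 (f : R -> R -> C) : Prop :=
  smooth2 f /\
  forall k l p q, exists M, forall x y,
    Rabs x ^ k * Rabs y ^ l * Cmod (Cpartial f p q x y) <= M.

(** * Tempered distributions

    A functional is given on all functions, but only its values on Schwartz
    functions are constrained. Continuity is continuity for the topology of
    the Schwartz seminorms [sup |x^k D^l f|]. *)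

Definition tempered (T : (R -> C) -> C) : Prop :=
  (forall (a b : C) f g, schwartz f -> schwartz g ->
     T (fun x => (a * f x + b * g x)%C) = (a * T f + b * T g)%C) /\
  (forall f, schwartz f -> forall eps, 0 < eps ->
     exists (N : nat) (delta : R), 0 < delta /\
       forall g, schwartz g ->
         (forall k l x, (k <= N)%nat -> (l <= N)%nat ->
            Rabs x ^ k * Cmod (Cderive_n (fun s => (g s - f s)%C) l x) <= delta) ->
         Cmod (T g - T f)%C < eps).

Definition tempered2 (T : (R -> R -> C) -> C) : Prop :=
  (forall (a b : C) f g, schwartz2 f -> schwartz2 g ->
     T (fun x y => (a * f x y + b * g x y)%C) = (a * T f + b * T g)%C) /\
  (forall f, schwartz2 f -> forall eps, 0 < eps ->
     exists (N : nat) (delta : R), 0 < delta /\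
       forall g, schwartz2 g ->
         (forall k l p q x y,
            (k <= N)%nat -> (l <= N)%nat -> (p <= N)%nat -> (q <= N)%nat ->
            Rabs x ^ k * Rabs y ^ l *
              Cmod (Cpartial (fun u v => (g u v - f u v)%C) p q x y) <= delta) ->
         Cmod (T g - T f)%C < eps).

Definition tensor_fun (f g : R -> C) : R -> R -> C :=
  fun x y => (f x * g y)%C.

(** [<T1 (x) T2, psi> = <T1, x |-> <T2, psi(x, .)>>]; for tempered [T1], [T2]
    and Schwartz [psi] the inner function of [x] is again Schwartz. *)
Definition tensor_dist (T1 T2 : (R -> C) -> C) : (R -> R -> C) -> C :=
  fun psi => T1 (fun x => T2 (fun y => psi x y)).

(** * Generalised random variables *)

Record genrv : Type := GenRV {
  law : (R -> C) -> C;
  kernel : R -> C;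
  law_tempered : tempered law;
  kernel_schwartz : schwartz kernel
}.

Record genrv2 : Type := GenRV2 {
  law2 : (R -> R -> C) -> C;
  kernel2 : R -> R -> C;
  law2_tempered : tempered2 law2;
  kernel2_schwartz : schwartz2 kernel2
}.

(** [J] is the joint representation of [X] and [Y]. Laws are compared on
    Schwartz functions only, where they are meaningful. *)
Definition independent (X Y : genrv) (J : genrv2) : Prop :=
  (forall psi, schwartz2 psi -> law2 J psi = tensor_dist (law X) (law Y) psi) /\
  (forall x y, kernel2 J x y = tensor_fun (kernel X) (kernel Y) x y).

Definition weak_cf (X : genrv) (t : R) : C :=
  law X (fun x => (Cexp (Ci * RtoC (t * x)) * kernel X x)%C).

(** Weak characteristic function of the sum of the two components of [J]. *)
Definition weak_cf_sum (J : genrv2) (t : R) : C :=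
  law2 J (fun x y => (Cexp (Ci * RtoC (t * (x + y))) * kernel2 J x y)%C).

(** * Weak cumulant generating functions

    [K = log phi] near [0]: a continuous branch of the complex logarithm of
    [phi] on an open interval [U] around [0] on which [phi] does not vanish.
    Since [phi 0 = <T, kernel>] is an arbitrary nonzero complex number, there
    is no preferred branch, and [K] is determined by [phi] only up to a
    constant in [2 pi i Z]. *)

Definition interval_nbhd0 (U : R -> Prop) : Prop :=
  open U /\ U 0 /\ (forall x y z, U x -> U y -> x <= z <= y -> U z).

Definition is_log_on (phi : R -> C) (U : R -> Prop) (K : R -> C) : Prop :=
  interval_nbhd0 U /\
  forall t, U t -> phi t <> RtoC 0 /\ continuous K t /\ Cexp (K t) = phi t.

Definition is_weak_cgf (X : genrv) := is_log_on (weak_cf X).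
Definition is_weak_cgf_sum (J : genrv2) := is_log_on (weak_cf_sum J).

(* Main.v *)
Require Import Defs.
From Stdlib Require Import Reals Ranalysis5 Lra Lia FunctionalExtensionality.
From Coquelicot Require Import Coquelicot.
Open Scope R_scope.

(** The exponential [e^{it(x+y)}] factors, so the test function defining the weak
    characteristic function of [X + Y] is the tensor product of the modulated
    kernels; both are again Schwartz, since [(e^{itx} f)' = e^{itx} (i t f + f')].
    Linearity of the two laws then makes the weak characteristic functions
    multiply, hence the logarithms add. Two continuous logarithms of the same
    function differ by a continuous function with values in [2 pi i Z], which is
    constant on an interval. *)

(** * Linear combinations and derivatives of smooth real functions *)

Definition real_smooth (f : R -> R) : Prop := forall n x, ex_derive_n f n x.

Lemma real_smooth_derive f : real_smooth f -> real_smooth (Derive f).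
Proof.
  intros Hf [|n] x; [exact I|].
  apply ex_derive_ext with (Derive_n f (S n)).
  - intros y. rewrite <- Nat.add_1_r. symmetry. apply (Derive_n_comp f n 1).
  - exact (Hf (S (S n)) x).
Qed.

Lemma real_smooth_continuous f x : real_smooth f -> continuity_pt f x.
Proof.
  intros Hf. apply continuity_pt_filterlim.
  exact (ex_derive_continuous f x (Hf 1%nat x)).
Qed.

Lemma Derive_n_lincomb f g a b n x : real_smooth f -> real_smooth g ->
  Derive_n (fun y => a * f y + b * g y) n x = a * Derive_n f n x + b * Derive_n g n x.
Proof.
  intros Hf Hg. rewrite Derive_n_plus.
  - now rewrite !Derive_n_scal_l.
  - apply filter_forall. intros y k _. apply ex_derive_n_scal_l, Hf.
  - apply filter_forall. intros y k _. apply ex_derive_n_scal_l, Hg.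
Qed.

Lemma real_smooth_lincomb f g a b : real_smooth f -> real_smooth g ->
  real_smooth (fun y => a * f y + b * g y).
Proof.
  intros Hf Hg n x. apply ex_derive_n_plus.
  - apply filter_forall. intros y k _. apply ex_derive_n_scal_l, Hf.
  - apply filter_forall. intros y k _. apply ex_derive_n_scal_l, Hg.
Qed.

Lemma smooth_Re f : smooth f -> real_smooth (fun s => Re (f s)).
Proof. intros Hf n x. apply Hf. Qed.

Lemma smooth_Im f : smooth f -> real_smooth (fun s => Im (f s)).
Proof. intros Hf n x. apply Hf. Qed.

(** * The complex exponential *)

Lemma Cexp_plus z w : Cexp (z + w) = (Cexp z * Cexp w)%C.
Proof.
  destruct z as [a b], w as [c d]. unfold Cexp, Cmult, Cplus, Re, Im; simpl.
  rewrite exp_plus, cos_plus, sin_plus. f_equal; ring.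
Qed.

Lemma Cexp_Ci x : Cexp (Ci * RtoC x) = (cos x, sin x).
Proof.
  unfold Cexp, Cmult, Ci, RtoC, Re, Im; simpl.
  replace (0 * x - 1 * 0) with 0 by ring. replace (0 * 0 + 1 * x) with x by ring.
  rewrite exp_0. f_equal; ring.
Qed.

Lemma Cmod_Cexp z : Cmod (Cexp z) = exp (Re z).
Proof.
  unfold Cexp, Cmod; simpl fst; simpl snd.
  replace (_ + _) with (Rsqr (exp (Re z))).
  - rewrite sqrt_Rsqr; [reflexivity | left; apply exp_pos].
  - pose proof (sin2_cos2 (Im z)) as H. unfold Rsqr in *.
    transitivity (exp (Re z) * exp (Re z) * (sin (Im z) * sin (Im z) + cos (Im z) * cos (Im z))).
    + rewrite H. ring.
    + ring.
Qed.

(** * Modulation by [e^{itx}] preserves Schwartz functions *)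

Definition modulate (t : R) (f : R -> C) (x : R) : C := (Cexp (Ci * RtoC (t * x)) * f x)%C.

Lemma Cmod_modulate t f x : Cmod (modulate t f x) = Cmod (f x).
Proof.
  unfold modulate. rewrite Cmod_mult, Cmod_Cexp.
  replace (Re (Ci * RtoC (t * x))) with 0 by (simpl; ring).
  rewrite exp_0. ring.
Qed.

(** The operator [it + d/dx], which is [d/dx] conjugated by multiplication with [e^{itx}]; its
    iterates describe all derivatives of a modulated function. *)
Definition twisted_derive (t : R) (f : R -> C) (x : R) : C :=
  (Ci * RtoC t * f x + Cderive_n f 1 x)%C.

(** Stated between functions so that it rewrites under [Derive_n]; the factor [1] yields the shape
    [a * f + b * g] that [Derive_n_lincomb] expects. *)
Lemma Re_twisted_derive t f :
  (fun x => Re (twisted_derive t f x)) =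
  (fun x => - t * Im (f x) + 1 * Derive (fun s => Re (f s)) x).
Proof.
  apply functional_extensionality. intros x.
  unfold twisted_derive, Re, Im; simpl. unfold Re, Im. ring.
Qed.

Lemma Im_twisted_derive t f :
  (fun x => Im (twisted_derive t f x)) =
  (fun x => t * Re (f x) + 1 * Derive (fun s => Im (f s)) x).
Proof.
  apply functional_extensionality. intros x.
  unfold twisted_derive, Re, Im; simpl. unfold Re, Im. ring.
Qed.

Lemma Cderive_n_twisted_derive t f n x : smooth f ->
  Cderive_n (twisted_derive t f) n x =
  (Ci * RtoC t * Cderive_n f n x + Cderive_n f (S n) x)%C.
Proof.
  intros Hf. unfold Cderive_n. rewrite Re_twisted_derive, Im_twisted_derive.
  pose proof (smooth_Re f Hf) as HR. pose proof (smooth_Im f Hf) as HI.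
  rewrite !Derive_n_lincomb by (assumption || now apply real_smooth_derive).
  pose proof (Derive_n_comp (fun s => Re (f s)) n 1 x) as ER.
  pose proof (Derive_n_comp (fun s => Im (f s)) n 1 x) as EI.
  rewrite Nat.add_1_r in ER, EI.
  change (Derive (fun s => Re (f s))) with (Derive_n (fun s => Re (f s)) 1).
  change (Derive (fun s => Im (f s))) with (Derive_n (fun s => Im (f s)) 1).
  rewrite ER, EI. unfold Cplus, Cmult, Ci, RtoC; simpl. f_equal; ring.
Qed.

Lemma schwartz_twisted_derive t f : schwartz f -> schwartz (twisted_derive t f).
Proof.
  intros [Hf Hb]. split.
  - pose proof (smooth_Re f Hf) as HR. pose proof (smooth_Im f Hf) as HI.
    intros n x. rewrite Re_twisted_derive, Im_twisted_derive.
    split; apply real_smooth_lincomb; assumption || now apply real_smooth_derive.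
  - intros k l. destruct (Hb k l) as [M HM], (Hb k (S l)) as [N HN].
    exists (Rabs t * M + N). intros x. rewrite Cderive_n_twisted_derive by assumption.
    specialize (HM x). specialize (HN x).
    pose proof (Cmod_triangle (Ci * RtoC t * Cderive_n f l x) (Cderive_n f (S l) x)) as Ht.
    assert (Hi : Cmod Ci = 1).
    { unfold Cmod, Ci; simpl. replace (_ + _) with 1 by ring. apply sqrt_1. }
    rewrite !Cmod_mult, Hi, Cmod_R, Rmult_1_l in Ht.
    apply Rmult_le_compat_l with (r := Rabs x ^ k) in Ht;
      [|apply pow_le, Rabs_pos].
    apply Rmult_le_compat_l with (r := Rabs t) in HM; [|apply Rabs_pos].
    lra.
Qed.

(** The two functions are the real and imaginary parts of [e^{its} (a + ib)]. The derivatives are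
    grouped so that the brackets are the two parts of [twisted_derive]. *)
Lemma is_derive_rotation t a b x : ex_derive a x -> ex_derive b x ->
  is_derive (fun s => cos (t * s) * a s - sin (t * s) * b s) x
    (cos (t * x) * (- t * b x + 1 * Derive a x) - sin (t * x) * (t * a x + 1 * Derive b x)) /\
  is_derive (fun s => cos (t * s) * b s + sin (t * s) * a s) x
    (cos (t * x) * (t * a x + 1 * Derive b x) + sin (t * x) * (- t * b x + 1 * Derive a x)).
Proof.
  intros Ha Hb. split; (auto_derive; [now repeat split|]);
    change (Derive (fun s => a s) x) with (Derive a x);
    change (Derive (fun s => b s) x) with (Derive b x); ring.
Qed.

Lemma is_derive_modulate t f x : smooth f ->
  is_derive (fun s => Re (modulate t f s)) x (Re (modulate t (twisted_derive t f) x)) /\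
  is_derive (fun s => Im (modulate t f s)) x (Im (modulate t (twisted_derive t f) x)).
Proof.
  intros Hf.
  destruct (is_derive_rotation t (fun s : R => Re (f s)) (fun s : R => Im (f s)) x) as [HR HI];
    try apply (Hf 1%nat x).
  pose proof (f_equal (fun h => h x) (Re_twisted_derive t f)) as ER.
  pose proof (f_equal (fun h => h x) (Im_twisted_derive t f)) as EI.
  cbv beta in HR, HI, ER, EI. rewrite <- ER, <- EI in HR, HI.
  split; unfold modulate; rewrite Cexp_Ci;
    [refine (is_derive_ext _ _ _ _ _ HR)|refine (is_derive_ext _ _ _ _ _ HI)];
    intros s; rewrite Cexp_Ci; reflexivity.
Qed.

(** Each differentiation replaces [g] by [twisted_derive t g], which is again Schwartz. Only this
    membership matters later, so [g] stays existential. *)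
Lemma Cderive_n_modulate t f n : schwartz f ->
  exists g, schwartz g /\ forall x, Cderive_n (modulate t f) n x = modulate t g x.
Proof.
  intros Hf. induction n as [|n [g [Hg E]]].
  - exists f. split; [assumption|]. intros x. symmetry. apply surjective_pairing.
  - exists (twisted_derive t g). split; [now apply schwartz_twisted_derive|].
    intros x. destruct (is_derive_modulate t g x (proj1 Hg)) as [HR HI].
    apply injective_projections.
    + refine (eq_trans _ (is_derive_unique _ _ _ HR)).
      apply (Derive_ext (Derive_n (fun s => Re (modulate t f s)) n)).
      intros y. now rewrite <- E.
    + refine (eq_trans _ (is_derive_unique _ _ _ HI)).
      apply (Derive_ext (Derive_n (fun s => Im (modulate t f s)) n)).
      intros y. now rewrite <- E.
Qed.

Lemma schwartz_modulate t f : schwartz f -> schwartz (modulate t f).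
Proof.
  intros Hf. split.
  - intros [|n] x; [split; exact I|].
    destruct (Cderive_n_modulate t f n Hf) as [g [[Hg _] E]].
    destruct (is_derive_modulate t g x Hg) as [HR HI].
    split.
    + apply ex_derive_ext with (fun s => Re (modulate t g s)).
      * intros y. now rewrite <- E.
      * eexists; exact HR.
    + apply ex_derive_ext with (fun s => Im (modulate t g s)).
      * intros y. now rewrite <- E.
      * eexists; exact HI.
  - intros k l. destruct (Cderive_n_modulate t f l Hf) as [g [[Hg Hb] E]].
    (* The [l] derivatives are already absorbed into [g] and the modulation has modulus 1, so the
       seminorm of [g] of order [0] is the bound. *)
    destruct (Hb k 0%nat) as [M HM]. exists M. intros x.
    rewrite E, Cmod_modulate. specialize (HM x).
    unfold Cderive_n in HM; simpl in HM.
    now destruct (g x).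
Qed.

(** * Tensor products of Schwartz functions *)

Lemma continuity_2d_pt_fst a x y : continuity_pt a x ->
  continuity_2d_pt (fun u _ => a u) x y.
Proof.
  intros Ha. apply (continuity_1d_2d_pt_comp a (fun u _ => u)); [assumption|].
  apply continuity_2d_pt_id1.
Qed.

Lemma continuity_2d_pt_snd b x y : continuity_pt b y ->
  continuity_2d_pt (fun _ v => b v) x y.
Proof.
  intros Hb. apply (continuity_1d_2d_pt_comp b (fun _ v => v)); [assumption|].
  apply continuity_2d_pt_id2.
Qed.

(* Real and imaginary parts of a tensor product are sums of two real tensor
   products, a class of functions that is closed under partial derivatives. *)
Lemma ex_diff_n_tensor2 n a b c d x y :
  real_smooth a -> real_smooth b -> real_smooth c -> real_smooth d ->
  ex_diff_n (fun u v => a u * b v + c u * d v) n x y.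
Proof.
  revert a b c d. induction n as [|n IH]; intros a b c d Ha Hb Hc Hd;
    (split; [apply continuity_2d_pt_plus; apply continuity_2d_pt_mult;
      (apply continuity_2d_pt_fst || apply continuity_2d_pt_snd);
      now apply real_smooth_continuous|]); [exact I|].
  pose proof (fun z => Ha 1%nat z) as Ha1. pose proof (fun z => Hb 1%nat z) as Hb1.
  pose proof (fun z => Hc 1%nat z) as Hc1. pose proof (fun z => Hd 1%nat z) as Hd1.
  simpl in Ha1, Hb1, Hc1, Hd1.
  (* Equalities of functions, since [ex_diff_n] recurses on the partial derivatives as functions of
     both variables. *)
  assert (E1 : (fun u v => Derive (fun z => a z * b v + c z * d v) u) =
    (fun u v => Derive a u * b v + Derive c u * d v)).
  { apply functional_extensionality; intros u. apply functional_extensionality; intros v.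
    apply is_derive_unique. auto_derive; [now repeat split|].
    change (Derive (fun s => a s) u) with (Derive a u);
    change (Derive (fun s => c s) u) with (Derive c u). ring. }
  assert (E2 : (fun u v => Derive (fun z => a u * b z + c u * d z) v) =
    (fun u v => a u * Derive b v + c u * Derive d v)).
  { apply functional_extensionality; intros u. apply functional_extensionality; intros v.
    apply is_derive_unique. auto_derive; [now repeat split|].
    change (Derive (fun s => b s) v) with (Derive b v);
    change (Derive (fun s => d s) v) with (Derive d v). ring. }
  split; [auto_derive; now repeat split|].
  split; [auto_derive; now repeat split|].
  rewrite E1, E2. split; apply IH; assumption || now apply real_smooth_derive.
Qed.

Lemma partial_derive_tensor2 p q a b c d x y :
  real_smooth a -> real_smooth b -> real_smooth c -> real_smooth d ->
  partial_derive p q (fun u v => a u * b v + c u * d v) x y =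
  Derive_n a p x * Derive_n b q y + Derive_n c p x * Derive_n d q y.
Proof.
  intros Ha Hb Hc Hd. unfold partial_derive.
  rewrite (Derive_n_ext _ (fun u => Derive_n b q y * a u + Derive_n d q y * c u)).
  - rewrite Derive_n_lincomb by assumption. ring.
  - intros u. rewrite Derive_n_lincomb by assumption. ring.
Qed.

(** The minus sign is moved into a factor to reach the form [a b + c d], and that factor is padded
    with a zero term so that the lemmas on linear combinations apply to it. *)
Lemma Re_tensor_fun f g : (fun u v => Re (tensor_fun f g u v)) =
  (fun u v => Re (f u) * Re (g v) + (-1 * Im (f u) + 0 * Im (f u)) * Im (g v)).
Proof.
  apply functional_extensionality; intros u. apply functional_extensionality; intros v.
  unfold tensor_fun, Re, Im; simpl. ring.
Qed.

Lemma Im_tensor_fun f g : (fun u v => Im (tensor_fun f g u v)) =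
  (fun u v => Re (f u) * Im (g v) + Im (f u) * Re (g v)).
Proof. reflexivity. Qed.

Lemma Cpartial_tensor_fun f g p q x y : smooth f -> smooth g ->
  Cpartial (tensor_fun f g) p q x y = (Cderive_n f p x * Cderive_n g q y)%C.
Proof.
  intros Hf Hg.
  pose proof (smooth_Re f Hf) as Rf. pose proof (smooth_Im f Hf) as If.
  pose proof (smooth_Re g Hg) as Rg. pose proof (smooth_Im g Hg) as Ig.
  unfold Cpartial. rewrite Re_tensor_fun, Im_tensor_fun.
  rewrite (partial_derive_tensor2 p q (fun u => Re (f u)) (fun v => Re (g v))
    (fun u => -1 * Im (f u) + 0 * Im (f u)) (fun v => Im (g v)))
    by (assumption || now apply real_smooth_lincomb).
  rewrite Derive_n_lincomb by assumption.
  rewrite (partial_derive_tensor2 p q (fun u => Re (f u)) (fun v => Im (g v))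
    (fun u => Im (f u)) (fun v => Re (g v))) by assumption.
  unfold Cderive_n, Cmult; simpl. f_equal. ring.
Qed.

Lemma schwartz2_tensor_fun f g : schwartz f -> schwartz g -> schwartz2 (tensor_fun f g).
Proof.
  intros [Hf Bf] [Hg Bg]. split.
  - pose proof (smooth_Re f Hf) as Rf. pose proof (smooth_Im f Hf) as If.
    pose proof (smooth_Re g Hg) as Rg. pose proof (smooth_Im g Hg) as Ig.
    intros n x y. rewrite Re_tensor_fun, Im_tensor_fun. split.
    + apply (ex_diff_n_tensor2 n (fun u => Re (f u)) (fun v => Re (g v))
        (fun u => -1 * Im (f u) + 0 * Im (f u)) (fun v => Im (g v)));
        assumption || now apply real_smooth_lincomb.
    + now apply (ex_diff_n_tensor2 n (fun u => Re (f u)) (fun v => Im (g v))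
        (fun u => Im (f u)) (fun v => Re (g v))).
  - intros k l p q. destruct (Bf k p) as [M HM], (Bg l q) as [N HN].
    exists (M * N). intros x y. rewrite Cpartial_tensor_fun, Cmod_mult by assumption.
    (* The weighted modulus splits into a factor in [x] and a factor in [y], each bounded by a
       seminorm. *)
    replace (_ * _) with ((Rabs x ^ k * Cmod (Cderive_n f p x)) *
      (Rabs y ^ l * Cmod (Cderive_n g q y))) by ring.
    apply Rmult_le_compat; trivial; apply Rmult_le_pos;
      (apply pow_le, Rabs_pos) || apply Cmod_ge_0.
Qed.

(** * Multiplicativity of the weak characteristic function *)

Lemma tempered_scal T c f : tempered T -> schwartz f ->
  T (fun x => (c * f x)%C) = (c * T f)%C.
Proof.
  intros [HT _] Hf. specialize (HT c (RtoC 0) f f Hf Hf).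
  replace (fun x => (c * f x + RtoC 0 * f x)%C) with (fun x => (c * f x)%C) in HT.
  - rewrite HT. ring.
  - apply functional_extensionality. intros x. ring.
Qed.

Lemma weak_cf_sum_independent X Y J t : independent X Y J ->
  weak_cf_sum J t = (weak_cf X t * weak_cf Y t)%C.
Proof.
  intros [HL HK]. unfold weak_cf_sum.
  pose proof (schwartz_modulate t _ (kernel_schwartz X)) as SX.
  pose proof (schwartz_modulate t _ (kernel_schwartz Y)) as SY.
  replace (fun x y => _) with (tensor_fun (modulate t (kernel X)) (modulate t (kernel Y))).
  (* Independence identifies the joint law with the tensor product on Schwartz functions only, hence
     the side condition. *)
  - rewrite HL by now apply schwartz2_tensor_fun.
    unfold tensor_dist, tensor_fun.
    (* For fixed [x] the first factor is a scalar for [law Y]; the value [weak_cf Y t] left behind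
       is in turn a scalar for [law X]. *)
    replace (fun x => law Y _) with (fun x => (weak_cf Y t * modulate t (kernel X) x)%C).
    + rewrite tempered_scal by (apply law_tempered || assumption).
      apply Cmult_comm.
    + apply functional_extensionality. intros x.
      rewrite (tempered_scal (law Y)) by (apply law_tempered || assumption).
      apply Cmult_comm.
  - apply functional_extensionality; intros x. apply functional_extensionality; intros y.
    rewrite HK. unfold tensor_fun, modulate.
    rewrite Rmult_plus_distr_l, RtoC_plus, Cmult_plus_distr_l, Cexp_plus. ring.
Qed.

(** * Periods of the exponential and continuous logarithms of 1 *)

Lemma Cexp_eq_1 z : Cexp z = RtoC 1 -> exists k : Z, z = (Ci * RtoC (2 * PI * IZR k))%C.
Proof.
  intros H.
  assert (HR : Re z = 0).
  { apply exp_inv. now rewrite exp_0, <- Cmod_Cexp, H, Cmod_1. }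
  pose proof (f_equal Re H) as Hc. unfold Cexp in Hc. simpl in Hc.
  rewrite HR, exp_0, Rmult_1_l in Hc.
  (* By [cos (2a) = 1 - 2 sin(a)^2], the equation [cos (Im z) = 1] becomes a zero of the sine at the
     half angle, hence a multiple of [PI]. *)
  assert (Hs : sin (Im z / 2) = 0).
  { replace (Im z) with (2 * (Im z / 2)) in Hc by field.
    rewrite cos_2a_sin in Hc. nra. }
  destruct (sin_eq_0_0 _ Hs) as [k Hk]. exists k.
  destruct z as [a b]. unfold Re, Im in *; simpl in *.
  apply injective_projections; simpl; nra.
Qed.

(** [IVT_interv] wants a sign change from negative to positive; [f - c] or [c - f] provides it
    according to the direction of crossing. *)
Lemma IVT_segment f a b c : a < b ->
  (forall x, a <= x <= b -> continuous f x) ->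
  f a < c < f b \/ f b < c < f a -> exists x, a <= x <= b /\ f x = c.
Proof.
  intros Hab Hf Hc.
  assert (Hcont : forall x, a <= x <= b -> continuity_pt f x).
  { intros x Hx. now apply continuity_pt_filterlim, Hf. }
  destruct Hc as [Hc|Hc].
  - destruct (IVT_interv (fun x => f x - c) a b) as [x [Hx Ex]]; try lra.
    + intros x Hx. apply continuity_pt_minus; [now apply Hcont|].
      now apply continuity_pt_const.
    + exists x. split; [assumption|lra].
  - destruct (IVT_interv (fun x => c - f x) a b) as [x [Hx Ex]]; try lra.
    + intros x Hx. apply continuity_pt_minus; [|now apply Hcont].
      now apply continuity_pt_const.
    + exists x. split; [assumption|lra].
Qed.

(* If the integer changed between [a] and [b], by the intermediate value theorem
   [Im D] would take an odd multiple of [PI] as value, where [Cexp D] is [-1]. *)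
Lemma continuous_log_1_const D a b : a < b ->
  (forall x, a <= x <= b -> continuous D x /\ Cexp (D x) = RtoC 1) -> D a = D b.
Proof.
  intros Hab HD.
  assert (Hcont : forall x, a <= x <= b -> continuous (fun s => Im (D s)) x).
  { intros x Hx. apply (continuous_comp D (fun z : C => snd z)); [now apply HD|].
    apply continuous_snd. }
  destruct (Cexp_eq_1 (D a)) as [m Hm]; [apply HD; lra|].
  destruct (Cexp_eq_1 (D b)) as [n Hn]; [apply HD; lra|].
  assert (Im_D : forall x k, D x = (Ci * RtoC (2 * PI * IZR k))%C ->
    Im (D x) = 2 * PI * IZR k).
  { intros x k ->. simpl. ring. }
  pose proof (Im_D _ _ Hm) as Im_a. pose proof (Im_D _ _ Hn) as Im_b.
  pose proof PI_RGT_0 as HPI.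
  (* Such a value would also be [2 * PI * IZR j], making the odd integer [2k + 1] equal to the even
     integer [2j]. *)
  assert (Hno : forall k x, a <= x <= b -> Im (D x) <> 2 * PI * IZR k + PI).
  { intros k x Hx E. destruct (Cexp_eq_1 (D x)) as [j Hj]; [now apply HD|].
    apply Im_D in Hj. rewrite E in Hj.
    assert (H : IZR (2 * k + 1) = IZR (2 * j)).
    { rewrite plus_IZR, !mult_IZR. nra. }
    apply eq_IZR in H. lia. }
  destruct (Z.lt_total m n) as [H|[H|H]].
  (* From [m + 1 <= n], the value [2 * PI * m + PI] lies strictly between the imaginary parts at the
     endpoints. *)
  - exfalso. apply Z.le_succ_l, IZR_le in H. rewrite succ_IZR in H.
    destruct (IVT_segment _ a b (2 * PI * IZR m + PI) Hab Hcont) as [x [Hx Ex]].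
    + left. rewrite Im_a, Im_b. nra.
    + exact (Hno m x Hx Ex).
  - now rewrite Hm, Hn, H.
  - exfalso. apply Z.le_succ_l, IZR_le in H. rewrite succ_IZR in H.
    destruct (IVT_segment _ a b (2 * PI * IZR n + PI) Hab Hcont) as [x [Hx Ex]].
    + right. rewrite Im_a, Im_b. nra.
    + exact (Hno n x Hx Ex).
Qed.

(** * Products and uniqueness of logarithms near 0 *)

Lemma interval_nbhd0_and U V : interval_nbhd0 U -> interval_nbhd0 V ->
  interval_nbhd0 (fun t => U t /\ V t).
Proof.
  intros [oU [U0 cU]] [oV [V0 cV]]. split; [now apply open_and|]. split; [now split|].
  intros x y z [Ux Vx] [Uy Vy] Hz. split; [now apply (cU x y)|now apply (cV x y)].
Qed.

Lemma is_log_on_mult phi psi chi U V K L :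
  (forall t, chi t = (phi t * psi t)%C) -> is_log_on phi U K -> is_log_on psi V L ->
  is_log_on chi (fun t => U t /\ V t) (fun t => (K t + L t)%C).
Proof.
  intros E [HU HK] [HV HL]. split; [now apply interval_nbhd0_and|].
  intros t [Ut Vt]. destruct (HK t Ut) as [nzK [cK eK]], (HL t Vt) as [nzL [cL eL]].
  rewrite E. split; [now apply Cmult_neq_0|]. split.
  - exact (continuous_plus (V := C_NormedModule) K L t cK cL).
  - now rewrite Cexp_plus, eK, eL.
Qed.

Lemma is_log_on_unique phi U W K L : is_log_on phi U K -> is_log_on phi W L ->
  exists k : Z, forall t, U t -> W t -> L t = (K t + Ci * RtoC (2 * PI * IZR k))%C.
Proof.
  intros [HU HK] [HW HL].
  destruct (interval_nbhd0_and _ _ HU HW) as [_ [I0 cI]].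
  set (D := fun t => (L t - K t)%C).
  assert (HD : forall t, U t /\ W t -> continuous D t /\ Cexp (D t) = RtoC 1).
  { intros t [Ut Wt]. destruct (HK t Ut) as [nz [cK eK]], (HL t Wt) as [_ [cL eL]].
    split; [exact (continuous_minus (V := C_NormedModule) L K t cL cK)|].
    (* Here [phi] is both [Cexp K] and [Cexp L]; dividing by its nonzero value gives
       [Cexp D = 1]. *)
    assert (E : (phi t * Cexp (D t))%C = phi t).
    { rewrite <- eK at 1. rewrite <- Cexp_plus, <- eL. f_equal. unfold D. ring. }
    replace (Cexp (D t)) with (phi t * Cexp (D t) / phi t)%C by now field.
    rewrite E. now field. }
  destruct (Cexp_eq_1 (D 0)) as [k Hk]; [now apply HD|].
  exists k. intros t Ut Wt. rewrite <- Hk.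
  (* The segment joining [0] to [t] lies in both intervals, so the integer read off at [0] is valid
     at [t]. *)
  assert (E : D 0 = D t).
  { destruct (Rtotal_order 0 t) as [H|[H|H]].
    - apply continuous_log_1_const; [assumption|].
      intros x Hx. now apply HD, (cI 0 t).
    - now rewrite H.
    - symmetry. apply continuous_log_1_const; [assumption|].
      intros x Hx. now apply HD, (cI t 0). }
  rewrite E. unfold D. ring.
Qed.

Theorem theorem3p5 (X Y : genrv) (J : genrv2) (U V : R -> Prop) (KX KY : R -> C)
    (hind : independent X Y J)
    (hX : is_weak_cgf X U KX) (hY : is_weak_cgf Y V KY) :
  is_weak_cgf_sum J (fun t => U t /\ V t) (fun t => (KX t + KY t)%C) /\
  forall (W : R -> Prop) (KXY : R -> C), is_weak_cgf_sum J W KXY ->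
    (exists k : Z, forall t, U t -> V t -> W t ->
       KXY t = (KX t + KY t + Ci * RtoC (2 * PI * IZR k))%C) /\
    (KXY 0 = (KX 0 + KY 0)%C ->
       forall t, U t -> V t -> W t -> KXY t = (KX t + KY t)%C).
Proof.
  assert (HS : is_weak_cgf_sum J (fun t => U t /\ V t) (fun t => (KX t + KY t)%C)).
  { apply (is_log_on_mult (weak_cf X) (weak_cf Y)); try assumption.
    intros t. now apply weak_cf_sum_independent. }
  split; [exact HS|]. intros W KXY HW.
  destruct (is_log_on_unique _ _ _ _ _ HS HW) as [k Hk].
  split; [exists k; intros t Ut Vt; now apply Hk|].
  intros E0 t Ut Vt Wt.
  destruct HS as [[_ [[U0 V0] _]] _], HW as [[_ [W0 _]] _].
  pose proof (Hk 0 (conj U0 V0) W0) as Hk0. rewrite E0 in Hk0.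
  rewrite (Hk t (conj Ut Vt) Wt).
  (* The constant is rewritten as the discrepancy of the two logarithms at [0], which vanishes by
     [Hk0]. *)
  replace (Ci * RtoC (2 * PI * IZR k))%C with
    (KX 0 + KY 0 + Ci * RtoC (2 * PI * IZR k) - (KX 0 + KY 0))%C by ring.
  rewrite <- Hk0. ring.
Qed.
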